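(* For every finite multiset of formulas $\Gamma$ and every formula $\varphi$: if BSC-K$_3\vdash\Gamma\Rightarrow\varphi\mid\ \Rightarrow$ (the bisequent whose 1-sequent is $\Gamma\Rightarrow\varphi$ and whose 2-sequent is empty on both sides), then $\Gamma\models_{\mathbf{K}_3}\varphi$.
   Context: Formulas are built from propositional atoms with connectives $\neg,\wedge,\vee,\rightarrow$. A $\mathbf{K}_3$-valuation is a homomorphism $h$ from formulas to $\{0,u,1\}$ (ordered $0<u<1$) with: $h(\neg\varphi)=1,u,0$ when $h(\varphi)=0,u,1$; $h(\varphi\wedge\psi)=\min(h(\varphi),h(\psi))$; $h(\varphi\vee\psi)=\max(h(\varphi),h(\psi))$; $h(\varphi\rightarrow\psi)=\max(h(\neg\varphi),h(\psi))$. $\Gamma\models_{\mathbf{K}_3}\varphi$ means: for every valuation $h$, if $h(\gamma)=1$ for all $\gamma\in\Gamma$ then $h(\varphi)=1$. A sequent is $\Gamma\Rightarrow\Delta$ with $\Gamma,\Delta$ finite multisets of formulas; a bisequent is an ordered pair of sequents $\Gamma\Rightarrow\Delta\mid\Pi\Rightarrow\Sigma$. A bisequent is axiomatic iff some formula occurs in both $\Gamma$ and $\Sigma$, or in both $\Gamma$ and $\Delta$, or in both $\Pi$ and $\Sigma$. BSC-K$_3\vdash B$ means there is a finite tree of bisequents with root $B$, all of whose leaves are axiomatic, and in which every non-leaf node is the conclusion of an instance of one of the following rules whose premisses are exactly its children ($S$ denotes an arbitrary sequent): $(\neg\Rightarrow\mid)$: from $\Gamma\Rightarrow\Delta\mid\Pi\Rightarrow\Sigma,\varphi$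 infer $\neg\varphi,\Gamma\Rightarrow\Delta\mid\Pi\Rightarrow\Sigma$. $(\Rightarrow\neg\mid)$: from $\Gamma\Rightarrow\Delta\mid\varphi,\Pi\Rightarrow\Sigma$ infer $\Gamma\Rightarrow\Delta,\neg\varphi\mid\Pi\Rightarrow\Sigma$. $(\mid\neg\Rightarrow)$: from $\Gamma\Rightarrow\Delta,\varphi\mid\Pi\Rightarrow\Sigma$ infer $\Gamma\Rightarrow\Delta\mid\neg\varphi,\Pi\Rightarrow\Sigma$. $(\mid\Rightarrow\neg)$: from $\varphi,\Gamma\Rightarrow\Delta\mid\Pi\Rightarrow\Sigma$ infer $\Gamma\Rightarrow\Delta\mid\Pi\Rightarrow\Sigma,\neg\varphi$. $(\wedge\Rightarrow\mid)$: from $\varphi,\psi,\Gamma\Rightarrow\Delta\mid S$ infer $\varphi\wedge\psi,\Gamma\Rightarrow\Delta\mid S$. $(\Rightarrow\wedge\mid)$: from $\Gamma\Rightarrow\Delta,\varphi\mid S$ and $\Gamma\Rightarrow\Delta,\psi\mid S$ infer $\Gamma\Rightarrow\Delta,\varphi\wedge\psi\mid S$. $(\mid\wedge\Rightarrow)$: from $S\mid\varphi,\psi,\Gamma\Rightarrow\Delta$ infer $S\mid\varphi\wedge\psi,\Gamma\Rightarrow\Delta$. $(\mid\Rightarrow\wedge)$: from $S\mid\Gamma\Rightarrow\Delta,\varphi$ and $S\mid\Gamma\Rightarrow\Delta,\psi$ infer $S\mid\Gamma\Rightarrow\Delta,\varphi\wedge\psi$. $(\Rightarrow\vee\mid)$: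 from $\Gamma\Rightarrow\Delta,\varphi,\psi\mid S$ infer $\Gamma\Rightarrow\Delta,\varphi\vee\psi\mid S$. $(\vee\Rightarrow\mid)$: from $\varphi,\Gamma\Rightarrow\Delta\mid S$ and $\psi,\Gamma\Rightarrow\Delta\mid S$ infer $\varphi\vee\psi,\Gamma\Rightarrow\Delta\mid S$. $(\mid\Rightarrow\vee)$: from $S\mid\Gamma\Rightarrow\Delta,\varphi,\psi$ infer $S\mid\Gamma\Rightarrow\Delta,\varphi\vee\psi$. $(\mid\vee\Rightarrow)$: from $S\mid\varphi,\Gamma\Rightarrow\Delta$ and $S\mid\psi,\Gamma\Rightarrow\Delta$ infer $S\mid\varphi\vee\psi,\Gamma\Rightarrow\Delta$. $(\Rightarrow\rightarrow\mid)$: from $\Gamma\Rightarrow\Delta,\psi\mid\varphi,\Pi\Rightarrow\Sigma$ infer $\Gamma\Rightarrow\Delta,\varphi\rightarrow\psi\mid\Pi\Rightarrow\Sigma$. $(\mid\Rightarrow\rightarrow)$: from $\varphi,\Gamma\Rightarrow\Delta\mid\Pi\Rightarrow\Sigma,\psi$ infer $\Gamma\Rightarrow\Delta\mid\Pi\Rightarrow\Sigma,\varphi\rightarrow\psi$. $(\rightarrow\Rightarrow\mid)$: from $\Gamma\Rightarrow\Delta\mid\Pi\Rightarrow\Sigma,\varphi$ and $\psi,\Gamma\Rightarrow\Delta\mid\Pi\Rightarrow\Sigma$ infer $\varphi\rightarrow\psi,\Gamma\Rightarrow\Delta\mid\Pi\Rightarrow\Sigma$. $(\mid\rightarrow\Rightarrow)$: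 from $\Gamma\Rightarrow\Delta,\varphi\mid\Pi\Rightarrow\Sigma$ and $\Gamma\Rightarrow\Delta\mid\psi,\Pi\Rightarrow\Sigma$ infer $\Gamma\Rightarrow\Delta\mid\varphi\rightarrow\psi,\Pi\Rightarrow\Sigma$. *)

(* Defs.v *)
From HB Require Import structures.
From mathcomp Require Import all_boot all_order.
From mathcomp Require Import finmap multiset.

Set Implicit Arguments.
Unset Strict Implicit.
Unset Printing Implicit Defensive.

Local Open Scope mset_scope.

(* {mset _} is only available over a choiceType, hence the choiceType structure
   on formulas derived below from one on the atoms. *)
Inductive form (At : Type) : Type :=
| Atom of At
| Neg of form At
| And of form At & form At
| Or of form At & form At
| Imp of form At & form At.

Section FormChoice.
Variable At : Type.

Fixpoint form_to_tree (f : form At) : GenTree.tree At :=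
  match f with
  | Atom p => GenTree.Leaf p
  | Neg a => GenTree.Node 0 [:: form_to_tree a]
  | And a b => GenTree.Node 1 [:: form_to_tree a; form_to_tree b]
  | Or a b => GenTree.Node 2 [:: form_to_tree a; form_to_tree b]
  | Imp a b => GenTree.Node 3 [:: form_to_tree a; form_to_tree b]
  end.

Fixpoint form_of_tree (t : GenTree.tree At) : option (form At) :=
  match t with
  | GenTree.Leaf p => Some (Atom p)
  | GenTree.Node 0 [:: a] => omap (@Neg At) (form_of_tree a)
  | GenTree.Node 1 [:: a; b] =>
      obind (fun x => omap (And x) (form_of_tree b)) (form_of_tree a)
  | GenTree.Node 2 [:: a; b] =>
      obind (fun x => omap (Or x) (form_of_tree b)) (form_of_tree a)
  | GenTree.Node 3 [:: a; b] =>
      obind (fun x => omap (Imp x) (form_of_tree b)) (form_of_tree a)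
  | _ => None
  end.

Lemma form_to_treeK : pcancel form_to_tree form_of_tree.
Proof. by elim=> //= [a ->|a -> b ->|a -> b ->|a -> b ->]. Qed.

End FormChoice.

HB.instance Definition _ (At : eqType) :=
  Equality.copy (form At) (pcan_type (@form_to_treeK At)).
HB.instance Definition _ (At : choiceType) :=
  Choice.copy (form At) (pcan_type (@form_to_treeK At)).

Inductive K3 : Type := K3_0 | K3_u | K3_1.

Definition K3_rank (x : K3) : nat :=
  match x with K3_0 => 0 | K3_u => 1 | K3_1 => 2 end.

Definition K3_of_rank (n : nat) : K3 := nth K3_0 [:: K3_0; K3_u; K3_1] n.

Lemma K3_rankK : cancel K3_rank K3_of_rank.
Proof. by case. Qed.

HB.instance Definition _ := Equality.copy K3 (can_type K3_rankK).
HB.instance Definition _ := Choice.copy K3 (can_type K3_rankK).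

Definition K3_le : rel K3 := fun x y => (K3_rank x <= K3_rank y)%N.

Lemma K3_le_anti : antisymmetric K3_le.
Proof. by case; case. Qed.

Lemma K3_le_trans : transitive K3_le.
Proof. by case; case; case. Qed.

Lemma K3_le_total : total K3_le.
Proof. by case; case. Qed.

Fact K3_display : Order.disp_t. Proof. exact: Order.Disp tt tt. Qed.

HB.instance Definition _ := Order.Le_isPOrder.Build K3_display K3
  (fun x => leqnn (K3_rank x)) K3_le_anti K3_le_trans.
HB.instance Definition _ := Order.POrder_isTotal.Build K3_display K3 K3_le_total.

Definition K3_neg (x : K3) : K3 :=
  match x with K3_0 => K3_1 | K3_u => K3_u | K3_1 => K3_0 end.

Record valuation (At : Type) (h : form At -> K3) : Prop := Valuation {
  val_neg : forall a, h (Neg a) = K3_neg (h a);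
  val_and : forall a b, h (And a b) = Order.min (h a) (h b);
  val_or : forall a b, h (Or a b) = Order.max (h a) (h b);
  val_imp : forall a b, h (Imp a b) = Order.max (h (Neg a)) (h b)
}.

Definition K3_entails (At : Type) (Gamma : {pred form At}) (phi : form At) :
    Prop :=
  forall h : form At -> K3, valuation h ->
    (forall gamma, gamma \in Gamma -> h gamma = K3_1) -> h phi = K3_1.

Record sequent (At : choiceType) : Type := Sequent {
  antecedent : {mset form At};
  succedent : {mset form At}
}.

Record bisequent (At : choiceType) : Type := Bisequent {
  sequent1 : sequent At;
  sequent2 : sequent At
}.

Declare Scope bisequent_scope.
Delimit Scope bisequent_scope with bisequent.
Bind Scope bisequent_scope with sequent bisequent.

Notation "G |=> D" := (Sequent G%mset D%mset)
  (at level 68, no associativity) : bisequent_scope.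
Notation "S1 <|> S2" := (Bisequent S1 S2)
  (at level 69, no associativity) : bisequent_scope.

Local Open Scope bisequent_scope.

Definition axiomatic (At : choiceType) (B : bisequent At) : Prop :=
  let: (G |=> D) <|> (P |=> Q) := B in
  exists phi : form At,
    [|| (phi \in G) && (phi \in Q),
        (phi \in G) && (phi \in D)
      | (phi \in P) && (phi \in Q)].

(* In a rule name, L/R is the side of the principal formula and 1/2 is the
   component of the bisequent it occurs in.  The rules have finitely many
   premisses and the predicate is inductive, so a proof of [derivable B] is a
   finite derivation tree with root [B]. *)
Inductive derivable (At : choiceType) : bisequent At -> Prop :=
| derivable_leaf B : axiomatic B -> derivable B
| rule_negL1 G D P Q phi :
    derivable (G |=> D <|> P |=> phi +` Q) ->
    derivable (Neg phi +` G |=> D <|> P |=> Q)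
| rule_negR1 G D P Q phi :
    derivable (G |=> D <|> phi +` P |=> Q) ->
    derivable (G |=> Neg phi +` D <|> P |=> Q)
| rule_negL2 G D P Q phi :
    derivable (G |=> phi +` D <|> P |=> Q) ->
    derivable (G |=> D <|> Neg phi +` P |=> Q)
| rule_negR2 G D P Q phi :
    derivable (phi +` G |=> D <|> P |=> Q) ->
    derivable (G |=> D <|> P |=> Neg phi +` Q)
| rule_andL1 G D S phi psi :
    derivable (phi +` (psi +` G) |=> D <|> S) ->
    derivable (And phi psi +` G |=> D <|> S)
| rule_andR1 G D S phi psi :
    derivable (G |=> phi +` D <|> S) ->
    derivable (G |=> psi +` D <|> S) ->
    derivable (G |=> And phi psi +` D <|> S)
| rule_andL2 S G D phi psi :
    derivable (S <|> phi +` (psi +` G) |=> D) ->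
    derivable (S <|> And phi psi +` G |=> D)
| rule_andR2 S G D phi psi :
    derivable (S <|> G |=> phi +` D) ->
    derivable (S <|> G |=> psi +` D) ->
    derivable (S <|> G |=> And phi psi +` D)
| rule_orR1 G D S phi psi :
    derivable (G |=> phi +` (psi +` D) <|> S) ->
    derivable (G |=> Or phi psi +` D <|> S)
| rule_orL1 G D S phi psi :
    derivable (phi +` G |=> D <|> S) ->
    derivable (psi +` G |=> D <|> S) ->
    derivable (Or phi psi +` G |=> D <|> S)
| rule_orR2 S G D phi psi :
    derivable (S <|> G |=> phi +` (psi +` D)) ->
    derivable (S <|> G |=> Or phi psi +` D)
| rule_orL2 S G D phi psi :
    derivable (S <|> phi +` G |=> D) ->
    derivable (S <|> psi +` G |=> D) ->
    derivable (S <|> Or phi psi +` G |=> D)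
| rule_impR1 G D P Q phi psi :
    derivable (G |=> psi +` D <|> phi +` P |=> Q) ->
    derivable (G |=> Imp phi psi +` D <|> P |=> Q)
| rule_impR2 G D P Q phi psi :
    derivable (phi +` G |=> D <|> P |=> psi +` Q) ->
    derivable (G |=> D <|> P |=> Imp phi psi +` Q)
| rule_impL1 G D P Q phi psi :
    derivable (G |=> D <|> P |=> phi +` Q) ->
    derivable (psi +` G |=> D <|> P |=> Q) ->
    derivable (Imp phi psi +` G |=> D <|> P |=> Q)
| rule_impL2 G D P Q phi psi :
    derivable (G |=> phi +` D <|> P |=> Q) ->
    derivable (G |=> D <|> psi +` P |=> Q) ->
    derivable (G |=> D <|> Imp phi psi +` P |=> Q).

(* Main.v *)
(** Soundness by descent of countermodels: a valuation refutes a bisequent when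
    it makes the formulas of the four multisets respectively true, not true,
    not false and false.  No valuation refutes an axiomatic bisequent, and a
    refutation of the conclusion of a rule refutes one of its premisses. *)
Require Import Defs.
From HB Require Import structures.
From mathcomp Require Import all_boot all_order.
From mathcomp Require Import finmap multiset.

Local Open Scope mset_scope.
Local Open Scope bisequent_scope.

Definition mset_all {T : choiceType} (p : pred T) (A : {mset T}) : Prop :=
  forall x, x \in A -> p x.

Lemma mset_all1D (T : choiceType) (p : pred T) (a : T) (A : {mset T}) :
  mset_all p (a +` A) <-> p a /\ mset_all p A.
Proof.
split=> [pA | [pa pA] x].
  by split=> [|x xA]; apply: pA; rewrite in_mset1D ?eqxx ?xA ?orbT.
by rewrite in_mset1D => /orP[/eqP -> | /pA].
Qed.

Definition refutes {At : choiceType} (h : form At -> K3) (B : bisequent At) :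
    Prop :=
  let: (G |=> D) <|> (P |=> Q) := B in
  (mset_all (fun x => h x == K3_1) G /\ mset_all (fun x => h x != K3_1) D) /\
  (mset_all (fun x => h x != K3_0) P /\ mset_all (fun x => h x == K3_0) Q).

(** The shared formula would be true and false, true and not true, or not false and false. A formula
    shared by [D] and [P] can be refuted, with value [K3_u]. *)
Lemma axiomatic_not_refutes (At : choiceType) (h : form At -> K3)
    (B : bisequent At) :
  axiomatic B -> ~ refutes h B.
Proof.
case: B => [[G D] [P Q]] [x /or3P[] /andP[xl xr]] [[hG hD] [hP hQ]].
- by move: (hG x xl); rewrite (eqP (hQ x xr)).
- by move: (hD x xr); rewrite hG.
- by move: (hP x xl); rewrite hQ.
Qed.

Lemma K3_neg_eq1 (x : K3) : (K3_neg x == K3_1) = (x == K3_0).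
Proof. by case: x. Qed.

Lemma K3_neg_eq0 (x : K3) : (K3_neg x == K3_0) = (x == K3_1).
Proof. by case: x. Qed.

Lemma K3_min_eq1 (x y : K3) :
  (Order.min x y == K3_1) = (x == K3_1) && (y == K3_1).
Proof. by case: x; case: y. Qed.

Lemma K3_min_eq0 (x y : K3) :
  (Order.min x y == K3_0) = (x == K3_0) || (y == K3_0).
Proof. by case: x; case: y. Qed.

Lemma K3_max_eq1 (x y : K3) :
  (Order.max x y == K3_1) = (x == K3_1) || (y == K3_1).
Proof. by case: x; case: y. Qed.

Lemma K3_max_eq0 (x y : K3) :
  (Order.max x y == K3_0) = (x == K3_0) && (y == K3_0).
Proof. by case: x; case: y. Qed.

(** Reduces the tests for [K3_1] and [K3_0] on a compound to the same tests on its parts. *)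
Definition K3_eqE := (K3_neg_eq1, K3_neg_eq0, K3_min_eq1, K3_min_eq0,
  K3_max_eq1, K3_max_eq0).

Lemma derivable_not_refutes (At : choiceType) (h : form At -> K3)
    (B : bisequent At) :
  valuation h -> derivable B -> ~ refutes h B.
Proof.
case=> hN hA hO hI der; elim: der => {B};
  first by move=> B /axiomatic_not_refutes.
all: intros;
  (* Splitting [S] lets [refutes] compute; reverted induction hypotheses are rewritten with the
     goal. *)
  repeat match goal with
  | S : sequent _ |- _ => destruct S
  | IH : ~ refutes _ _ |- _ => revert IH
  end;
  rewrite /refutes !mset_all1D !(hI, hN, hA, hO) !K3_eqE;
  (* These facts tell [tauto] the truth values of the boolean constants left by the case analysis on
     the tests. *)
  have [tt nff] : true /\ ~ false by [];
  case: (h phi == K3_0); case: (h phi == K3_1) => /=;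
  try (case: (h psi == K3_0); case: (h psi == K3_1) => /=);
  tauto.
Qed.

Theorem mainTheorem2 (At : choiceType) (Gamma : {mset form At})
    (phi : form At) :
  derivable (Gamma |=> [mset phi] <|> mset0 |=> mset0) ->
  K3_entails [in Gamma] phi.
Proof.
move=> der h val_h hGamma; apply/eqP/negPn/negP => hphi.
(* [h] refutes the root: [Gamma] is true, [phi] is not, and the empty 2-sequent imposes nothing. *)
apply: (derivable_not_refutes _ _ _ val_h der); split; split=> x.
- by move/hGamma ->.
- by rewrite in_mset1 => /eqP ->.
- by rewrite in_mset0.
- by rewrite in_mset0.
Qed.
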